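(* Let $\lambda\in\mathbb{R}$, let $r\ge 0$ be an integer, and let $a,a^{+}$ be boson operators, i.e. linear operators on a complex vector space with $aa^{+}-a^{+}a=1$. For every integer $n\ge 0$, $$(a^{+})^{r}(a^{+}a+r)_{n,\lambda}=(a^{+}a)_{n,\lambda}(a^{+})^{r}$$ and $$(a^{+}a+r)_{n,\lambda}=\sum_{k=0}^{n}{n+r \brace k+r}_{r,\lambda}(a^{+})^{k}a^{k}.$$
   Context: The boson annihilation and creation operators $a$, $a^{+}$ satisfy $[a,a^{+}]=aa^{+}-a^{+}a=1$ (the identity operator); they can be realized for instance by $a=\frac{d}{dx}$ and $a^{+}=x$ (multiplication by $x$). For $\lambda\in\mathbb{R}$ and $y$ a number, indeterminate or operator, $(y)_{0,\lambda}=1$ and $(y)_{n,\lambda}=y(y-\lambda)(y-2\lambda)\cdots(y-(n-1)\lambda)$ for $n\ge 1$ (for operators, scalars stand for scalar multiples of the identity). Also $(y)_{0}=1$ and $(y)_{n}=y(y-1)\cdots(y-n+1)$ for $n\ge1$. For an integer $r\ge 0$, the degenerate $r$-Stirling numbers of the second kind ${n+r \brace k+r}_{r,\lambda}$ ($0\le k\le n$) are defined by the polynomial identity $$(y+r)_{n,\lambda}=\sum_{k=0}^{n}{n+r \brace k+r}_{r,\lambda}(y)_{k}\quad (n\ge 0).$$ *)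

(* Defs.v *)
From HB Require Import structures.
From mathcomp Require Import all_boot all_order all_algebra.
From mathcomp Require Import complex.
From mathcomp Require Import boolp reals.

Set Implicit Arguments.
Unset Strict Implicit.
Unset Printing Implicit Defensive.

Import GRing.Theory.
Local Open Scope ring_scope.

(* The endomorphism ring of a possibly infinite-dimensional module; it is only
   a pzRingType because V may be 0. *)
Definition linop (K : comPzRingType) (V : lmodType K) : Type := {linear V -> V}.

Section LinOp.
Variables (K : comPzRingType) (V : lmodType K).
Implicit Types (f g h : linop V) (c : K).

HB.instance Definition _ := gen_eqMixin (linop V).
HB.instance Definition _ := gen_choiceMixin (linop V).

Lemma linopP f g : (forall v, f v = g v) -> f = g.
Proof.
case: f => f [[f1] [f2]]; case: g => g [[g1] [g2]] /= /funext fg.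
case: g / fg g1 g2 => g1 g2.
by rewrite (Prop_irrelevance g1 f1) (Prop_irrelevance g2 f2).
Qed.

Definition linop_zero : linop V := \0 : {linear V -> V}.
Definition linop_opp f : linop V := \- f : {linear V -> V}.
Definition linop_add f g : linop V := f \+ g : {linear V -> V}.
Definition linop_one : linop V := idfun : {linear V -> V}.
Definition linop_mul f g : linop V := f \o g : {linear V -> V}.
Definition linop_scale c f : linop V := c \*: f : {linear V -> V}.

Fact linop_addA : associative linop_add.
Proof. by move=> f g h; apply: linopP => v /=; rewrite addrA. Qed.
Fact linop_addC : commutative linop_add.
Proof. by move=> f g; apply: linopP => v /=; rewrite addrC. Qed.
Fact linop_add0 : left_id linop_zero linop_add.
Proof. by move=> f; apply: linopP => v /=; rewrite add0r. Qed.
Fact linop_addN : left_inverse linop_zero linop_opp linop_add.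
Proof. by move=> f; apply: linopP => v /=; rewrite addNr. Qed.
HB.instance Definition _ := GRing.isZmodule.Build (linop V)
  linop_addA linop_addC linop_add0 linop_addN.

Fact linop_mulA : associative linop_mul.
Proof. by move=> f g h; apply: linopP. Qed.
Fact linop_mul1 : left_id linop_one linop_mul.
Proof. by move=> f; apply: linopP. Qed.
Fact linop_mulr1 : right_id linop_one linop_mul.
Proof. by move=> f; apply: linopP. Qed.
Fact linop_mulDl : left_distributive linop_mul linop_add.
Proof. by move=> f g h; apply: linopP. Qed.
Fact linop_mulDr : right_distributive linop_mul linop_add.
Proof. by move=> f g h; apply: linopP => v /=; rewrite linearD. Qed.
HB.instance Definition _ := GRing.Zmodule_isPzRing.Build (linop V)
  linop_mulA linop_mul1 linop_mulr1 linop_mulDl linop_mulDr.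

Fact linop_scaleA c d f :
  linop_scale c (linop_scale d f) = linop_scale (c * d) f.
Proof. by apply: linopP => v /=; rewrite scalerA. Qed.
Fact linop_scale1 : left_id 1 linop_scale.
Proof. by move=> f; apply: linopP => v /=; rewrite scale1r. Qed.
Fact linop_scaleDr : right_distributive linop_scale +%R.
Proof. by move=> c f g; apply: linopP => v /=; rewrite scalerDr. Qed.
Fact linop_scaleDl f : {morph linop_scale^~ f : c d / c + d}.
Proof. by move=> c d; apply: linopP => v /=; rewrite scalerDl. Qed.
HB.instance Definition _ := GRing.Zmodule_isLmodule.Build K (linop V)
  linop_scaleA linop_scale1 linop_scaleDr linop_scaleDl.

Definition scalop c : linop V := c *: (1 : linop V).

Lemma linop_addE f g v : (f + g) v = f v + g v. Proof. by []. Qed.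
Lemma linop_oppE f v : (- f) v = - f v. Proof. by []. Qed.
Lemma linop_oneE v : (1 : linop V) v = v. Proof. by []. Qed.
Lemma linop_mulE f g v : (f * g) v = f (g v). Proof. by []. Qed.
Lemma linop_scaleE c f v : (c *: f) v = c *: f v. Proof. by []. Qed.
Lemma scalopE c v : scalop c v = c *: v. Proof. by []. Qed.

End LinOp.

Arguments scalop {K V} c.

(* (y)_{n,lam}; lam lives in the same ring A as y, so that one definition
   serves polynomials (lam%:P) and operators (scalop lam%:C). *)
Definition dfact (A : pzRingType) (y lam : A) (n : nat) : A :=
  \prod_(i < n) (y - lam *+ i).

(* (y)_n *)
Definition ffact (A : pzRingType) (y : A) (n : nat) : A :=
  \prod_(i < n) (y - i%:R).

Section DegenerateStirling.
Variable R : realType.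
Implicit Types (lam : R) (p : {poly R}) (r n k : nat).

Definition is_rstirling2 lam r n (s : {ffun 'I_n.+1 -> R}) : bool :=
  dfact ('X + r%:R) lam%:P n == \sum_(k < n.+1) s k *: ffact 'X k.

Lemma monic_ffactX n : ffact ('X : {poly R}) n \is monic.
Proof. by apply: monic_prod => i _; rewrite -polyC_natr monicXsubC. Qed.

Lemma size_ffactX n : size (ffact ('X : {poly R}) n) = n.+1.
Proof.
rewrite /ffact; under eq_bigr do rewrite -polyC_natr.
by rewrite size_prod_XsubC [index_enum _]unlock -enumT size_enum_ord.
Qed.

Lemma ffactX_span n p : (size p <= n)%N ->
  exists s : nat -> R, p = \sum_(k < n) s k *: ffact 'X k.
Proof.
elim: n p => [|n IHn] p sp.
  by exists (fun=> 0); rewrite big_ord0; apply/eqP; rewrite -size_poly_leq0.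
have [|s Es] := IHn (p - p`_n *: ffact 'X n).
  apply/leq_sizeP => j; rewrite leq_eqVlt => /orP[/eqP<-|nj].
    rewrite coefB coefZ; have := monicP (monic_ffactX n).
    by rewrite lead_coefE size_ffactX /= => ->; rewrite mulr1 subrr.
  rewrite coefB coefZ (nth_default _ (leq_trans sp nj)).
  by rewrite [X in _ * X]nth_default ?size_ffactX// mulr0 subrr.
exists (fun k => if k == n then p`_n else s k).
rewrite big_ord_recr /= eqxx -[LHS](subrK (p`_n *: ffact 'X n)) {1}Es.
by congr (_ + _); apply: eq_bigr => i _; rewrite ltn_eqF.
Qed.

Lemma ffactX_free n (s : nat -> R) :
  \sum_(k < n) s k *: ffact ('X : {poly R}) k = 0 ->
  forall k, (k < n)%N -> s k = 0.
Proof.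
elim: n => // n IHn; rewrite big_ord_recr /= => E.
have sn0 : s n = 0.
  have /(congr1 (fun p : {poly R} => p`_n)) := E.
  rewrite coefD coefZ coef0 coef_sum big1 => [|i _].
    have := monicP (monic_ffactX n).
    by rewrite lead_coefE size_ffactX /= add0r => ->; rewrite mulr1.
  by rewrite coefZ nth_default ?mulr0// size_ffactX.
move=> k; rewrite ltnS leq_eqVlt => /orP[/eqP->//|].
by apply: IHn; rewrite sn0 scale0r addr0 in E.
Qed.

Lemma rstirling2_exists lam r n :
  exists s : {ffun 'I_n.+1 -> R}, is_rstirling2 lam r s.
Proof.
have [|s Es] := @ffactX_span n.+1 (dfact ('X + r%:R) lam%:P n).
  rewrite /dfact; under eq_bigr => i _.
    rewrite -polyC_natr -polyCMn -addrA -polyCB -[_%:P]opprK -polyCN; over.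
  by rewrite size_prod_XsubC [index_enum _]unlock -enumT size_enum_ord.
exists [ffun k => s (val k)]; rewrite /is_rstirling2 Es.
by apply/eqP; apply: eq_bigr => k _; rewrite ffunE.
Qed.

Lemma rstirling2_unique lam r n (s t : {ffun 'I_n.+1 -> R}) :
  is_rstirling2 lam r s -> is_rstirling2 lam r t -> s = t.
Proof.
rewrite /is_rstirling2 => /eqP-> /eqP/esym/eqP; rewrite -subr_eq0 -sumrB => /eqP E.
have := @ffactX_free n.+1 (fun k => t (inord k) - s (inord k)).
under eq_bigr do rewrite inord_val scalerBl.
move=> /(_ E) H; apply/ffunP => k; apply/esym/eqP; rewrite -subr_eq0.
by rewrite -(H _ (ltn_ord k)) inord_val.
Qed.

(* rstirling2 lam r n k is the number written {n+r \brace k+r}_{r,lam}: the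
   arguments n and k are not shifted by r.  It is the unique family satisfying
   the defining polynomial identity. *)
Definition rstirling2 lam r n (k : 'I_n.+1) : R :=
  xchoose (rstirling2_exists lam r n) k.

Lemma rstirling2P lam r n :
  dfact ('X + r%:R) lam%:P n =
    \sum_(k < n.+1) rstirling2 lam r k *: ffact 'X k.
Proof. exact/eqP/(xchooseP (rstirling2_exists lam r n)). Qed.

End DegenerateStirling.

Arguments rstirling2 {R} lam r n k.

(* Main.v *)
(* Write x = a^+ a. From a a^+ = x + 1 one gets x (a^+)^r = (a^+)^r (x + r), which
   intertwines the two degenerate factorials factor by factor, and
   a^k x = (x + k) a^k, whence (x)_k = (a^+)^k a^k. The second identity is then
   the polynomial identity defining the r-Stirling numbers, evaluated at x. *)
Require Import Defs.
From HB Require Import structures.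
From mathcomp Require Import all_boot all_order all_algebra.
From mathcomp Require Import complex.
From mathcomp Require Import boolp reals.

Set Implicit Arguments.
Unset Strict Implicit.
Unset Printing Implicit Defensive.

Import GRing.Theory.
Local Open Scope ring_scope.
Local Open Scope complex_scope.

Lemma dfactS (A : pzRingType) (y lam : A) n :
  dfact y lam n.+1 = dfact y lam n * (y - lam *+ n).
Proof. by rewrite /dfact big_ord_recr. Qed.

Lemma ffactS (A : pzRingType) (y : A) n :
  ffact y n.+1 = ffact y n * (y - n%:R).
Proof. by rewrite /ffact big_ord_recr. Qed.

(** Since [u] commutes with [lam], each factor obeys [u * (y - lam *+ i) = (z - lam *+ i) * u], so
    [u] passes through the product one factor at a time. *)
Lemma dfact_intertwine (A : pzRingType) (u y z lam : A) n :
  u * y = z * u -> GRing.comm u lam ->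
  u * dfact y lam n = dfact z lam n * u.
Proof.
move=> uy ulam; elim: n => [|n IHn]; first by rewrite /dfact !big_ord0 mulr1 mul1r.
by rewrite !dfactS mulrA IHn -!mulrA mulrBr mulrBl uy (commrMn n ulam).
Qed.

Section Boson.
Variables (A : pzRingType) (a ap : A).
Hypothesis boson : a * ap - ap * a = 1.

Let aap : a * ap = ap * a + 1.
Proof. by rewrite -boson addrC subrK. Qed.

Lemma create_number r : ap ^+ r * (ap * a + r%:R) = ap * a * ap ^+ r.
Proof.
elim: r => [|r IHr]; first by rewrite addr0 expr0 mul1r mulr1.
(* Cancelling [ap ^+ r] on the left leaves [ap * (ap * a + r.+1%:R) = (ap * a + r%:R) * ap]. *)
rewrite exprSr [in RHS]mulrA -IHr -!mulrA; congr (_ * _).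
by rewrite mulrDl -mulrA aap !mulrDr !mulr1 -natr1 mulrDr mulr1 mulr_natl mulr_natr
           addrAC addrA.
Qed.

Lemma annihilate_number k : a ^+ k * (ap * a) = (ap * a + k%:R) * a ^+ k.
Proof.
elim: k => [|k IHk]; first by rewrite addr0 expr0 mul1r mulr1.
rewrite exprS -mulrA IHk !mulrA; congr (_ * _).
by rewrite mulrDr mulrA aap -natr1 !mulrDl mul1r mulr_natl mulr_natr addrAC addrA.
Qed.

(** Moving [a ^+ k] past the new factor [ap * a - k%:R] raises it by [k], which leaves exactly
    [ap * a] between [ap ^+ k] and [a ^+ k]. *)
Lemma ffact_number k : ffact (ap * a) k = ap ^+ k * a ^+ k.
Proof.
elim: k => [|k IHk]; first by rewrite /ffact big_ord0 mulr1.
rewrite ffactS IHk mulrBr -!mulrA annihilate_number mulrDl mulrDr.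
by rewrite mulr_natr mulr_natl addrK exprSr exprS !mulrA.
Qed.

End Boson.

(* MathComp's [horner] and [horner_alg] need a nontrivial ring of operators, but
   [linop V] is trivial when [V] is; hence this evaluation. *)
Section PolyEval.
Variables (R : nzRingType) (K : comPzRingType) (phi : {rmorphism R -> K}).
Variables (V : lmodType K) (x : linop V).
Implicit Types (p q : {poly R}) (f g : linop V).

Lemma linop_scaleAl c f g : c *: (f * g) = (c *: f) * g.
Proof. exact: linopP. Qed.

Lemma linop_scaleAr c f g : c *: (f * g) = f * (c *: g).
Proof. by apply: linopP => v; apply/esym/(linearZ_LR f). Qed.

Lemma comm_scalop c f : GRing.comm f (scalop c).
Proof. by rewrite /GRing.comm -linop_scaleAl -linop_scaleAr mul1r mulr1. Qed.

(** The map [phi] lets real polynomials act on a complex space. *)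
Definition poly_eval p : linop V := \sum_(i < size p) phi p`_i *: x ^+ i.

(** Padding with zero coefficients gives polynomials of different sizes a common summation range. *)
Lemma poly_eval_wide n p : (size p <= n)%N ->
  poly_eval p = \sum_(i < n) phi p`_i *: x ^+ i.
Proof.
move=> pn; rewrite /poly_eval (big_ord_widen n (fun i => phi p`_i *: x ^+ i) pn).
rewrite big_mkcond; apply: eq_bigr => i _; case: ltnP => // pi.
by rewrite nth_default// rmorph0 scale0r.
Qed.

Lemma poly_evalD p q : poly_eval (p + q) = poly_eval p + poly_eval q.
Proof.
rewrite (poly_eval_wide (size_polyD p q)) (poly_eval_wide (leq_maxl _ (size q))).
rewrite [poly_eval q](poly_eval_wide (leq_maxr (size p) _)) -big_split.
by apply: eq_bigr => i _; rewrite coefD rmorphD scalerDl.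
Qed.

Lemma poly_evalZ c p : poly_eval (c *: p) = phi c *: poly_eval p.
Proof.
rewrite (poly_eval_wide (size_scale_leq c p)) scaler_sumr.
by apply: eq_bigr => i _; rewrite coefZ rmorphM scalerA.
Qed.

Lemma poly_eval0 : poly_eval 0 = 0.
Proof. by rewrite /poly_eval size_poly0 big_ord0. Qed.

Lemma poly_eval1 : poly_eval 1 = 1.
Proof. by rewrite /poly_eval size_poly1 big_ord1 coef1 rmorph1 scale1r. Qed.

Lemma poly_eval_sum n (F : 'I_n -> {poly R}) :
  poly_eval (\sum_(i < n) F i) = \sum_(i < n) poly_eval (F i).
Proof. exact: (big_morph _ poly_evalD poly_eval0). Qed.

Lemma poly_evalMX p : poly_eval (p * 'X) = poly_eval p * x.
Proof.
(* The bound [(size p).+1] also covers [p = 0], where [p * 'X] has size 0. *)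
rewrite (@poly_eval_wide (size p).+1); last first.
  by rewrite (leq_trans (size_polyMleq _ _))// size_polyX addn2.
rewrite big_ord_recl coefMX rmorph0 scale0r add0r mulr_suml.
by apply: eq_bigr => i _; rewrite coefMX /= exprSr linop_scaleAl.
Qed.

End PolyEval.

Section EvalFactorials.
Variables (R : comNzRingType) (K : comPzRingType) (phi : {rmorphism R -> K}).
Variables (V : lmodType K) (x : linop V).

(** Multiplicativity for factors ['X + c%:P] suffices, as both kinds of factorial are products of
    such factors. *)
Lemma poly_evalMXaddC (p : {poly R}) c :
  poly_eval phi x (p * ('X + c%:P)) = poly_eval phi x p * (x + scalop (phi c)).
Proof.
rewrite mulrDr poly_evalD poly_evalMX [p * _]mulrC mul_polyC poly_evalZ mulrDr.
by rewrite -linop_scaleAr mulr1.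
Qed.

Lemma poly_eval_dfact r (lam : R) n :
  poly_eval phi x (dfact ('X + r%:R) lam%:P n)
    = dfact (x + r%:R) (scalop (phi lam)) n.
Proof.
elim: n => [|n IHn]; first by rewrite /dfact !big_ord0 poly_eval1.
rewrite !dfactS; have -> : 'X + r%:R - lam%:P *+ n = 'X + (r%:R - lam *+ n)%:P :> {poly R}.
  by rewrite polyCB polyC_natr polyCMn addrA.
rewrite poly_evalMXaddC IHn.
rewrite /scalop rmorphB rmorph_nat rmorphMn scalerBl scaler_nat scalerMnl.
by rewrite addrA.
Qed.

Lemma poly_eval_ffact n : poly_eval phi x (ffact 'X n) = ffact x n.
Proof.
elim: n => [|n IHn]; first by rewrite /ffact !big_ord0 poly_eval1.
rewrite !ffactS -polyC_natr -polyCN poly_evalMXaddC IHn.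
by rewrite /scalop rmorphN rmorph_nat scaleNr scaler_nat.
Qed.

End EvalFactorials.

Theorem theorem6 (R : realType) (lam : R) (r : nat) (V : lmodType R[i])
    (a ap : linop V) (boson : a * ap - ap * a = 1) (n : nat) :
  ap ^+ r * dfact (ap * a + r%:R) (scalop lam%:C) n
    = dfact (ap * a) (scalop lam%:C) n * ap ^+ r
  /\
  dfact (ap * a + r%:R) (scalop lam%:C) n
    = \sum_(k < n.+1) (rstirling2 lam r n k)%:C *: (ap ^+ k * a ^+ k).
Proof.
split; first exact: dfact_intertwine (create_number boson r) (comm_scalop _ _).
(* Evaluation at [ap * a] turns each [ffact 'X k] into the normally ordered [ap ^+ k * a ^+ k]. *)
have /(congr1 (poly_eval (real_complex R) (ap * a))) := rstirling2P lam r n.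
rewrite poly_eval_dfact poly_eval_sum => ->; apply: eq_bigr => k _.
by rewrite poly_evalZ poly_eval_ffact ffact_number.
Qed.
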